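(* Let $T$ be a moon polyomino and let $\mathcal{B}$ be any one of the sets $\mathcal{N}(T)$, $\mathcal{N}^c(T)$, $\mathcal{N}^r(T)$. Then the joint distribution of $(\mathrm{ne}_2,\mathrm{se}_2)$ over $\mathcal{B}$ is symmetric, i.e. $$\sum_{F\in\mathcal{B}}p^{\mathrm{ne}_2(F)}q^{\mathrm{se}_2(F)}=\sum_{F\in\mathcal{B}}p^{\mathrm{se}_2(F)}q^{\mathrm{ne}_2(F)}.$$
   Context: A polyomino is a finite set of unit square cells of the integer grid. A moon polyomino is a polyomino that is convex (every row of cells and every column of cells is a contiguous segment, without holes) and intersection-free (for any two rows, the set of horizontal positions of one is contained in that of the other; equivalently, the same for any two columns). A $01$-filling of $T$ assigns $0$ or $1$ to each cell of $T$. An ascent (NE-chain of length 2) of a filling $F$ is a pair of cells of $T$ both containing $1$, the second strictly above and strictly to the right of the first, such that the smallest rectangle containing both cells is contained in $T$; a descent (SE-chain of length 2) is defined in the same way with ''strictly below and strictly to the right''. $\mathrm{ne}_2(F)$ and $\mathrm{se}_2(F)$ denote the numbers of ascents and descents of $F$. $\mathcal{N}^c(T)$ (resp. $\mathcal{N}^r(T)$) is the set of $01$-fillings of $T$ with at most one $1$ in each column (resp. each row), and $\mathcal{N}(T)=\mathcal{N}^c(T)\cap\mathcal{N}^r(T)$. *)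

(* Defs.v *)
From mathcomp Require Import all_boot all_order all_algebra.
From mathcomp Require Import finmap.

Set Implicit Arguments.
Unset Strict Implicit.
Unset Printing Implicit Defensive.

Import Order.TTheory GRing.Theory Num.Theory.
Local Open Scope fset_scope.
Local Open Scope ring_scope.

(* The cell (x, y) lies in column x and row y; x grows to the right and y
   grows upwards. *)
Definition cell := (int * int)%type.

Definition polyomino := {fset cell}.

Definition row_of (T : polyomino) (y : int) : pred int := [pred x | (x, y) \in T].
Definition col_of (T : polyomino) (x : int) : pred int := [pred y | (x, y) \in T].

Definition contiguous (S : pred int) : Prop :=
  forall a b c : int, a <= b <= c -> a \in S -> c \in S -> b \in S.

Definition convex (T : polyomino) : Prop :=
  (forall y, contiguous (row_of T y)) /\ (forall x, contiguous (col_of T x)).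

Definition intersection_free (T : polyomino) : Prop :=
  forall y1 y2 : int,
    {subset row_of T y1 <= row_of T y2} \/ {subset row_of T y2 <= row_of T y1}.

Definition moon_polyomino (T : polyomino) : Prop :=
  convex T /\ intersection_free T.

(* The integers between a and b, in whichever order a and b come. *)
Definition int_range (a b : int) : seq int :=
  [seq Num.min a b + k%:Z | k <- iota 0 `|b - a|%N.+1].

Definition rect (c d : cell) : {fset cell} :=
  [fset ((x, y) : cell) | x in int_range c.1 d.1, y in int_range c.2 d.2].

Lemma mem_int_range (a b x : int) :
  (x \in int_range a b) = (Num.min a b <= x <= Num.max a b).
Proof.
apply/mapP/andP => [[k]|[hx1 hx2]].
  rewrite mem_iota add0n ltnS => /andP[_ hk] ->; split.
    by rewrite lerDl.
  have -> : Num.max a b = Num.min a b + `|b - a|%N%:Z.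
    rewrite abszE; case: (leP a b) => h.
      by rewrite ger0_norm ?subr_ge0 // addrCA subrr addr0.
    by rewrite ltr0_norm ?subr_lt0 // opprB addrCA subrr addr0.
  by rewrite lerD2l lez_nat.
exists `|x - Num.min a b|%N; last first.
  by rewrite abszE ger0_norm ?subr_ge0 // addrCA subrr addr0.
rewrite mem_iota add0n ltnS /= -lez_nat !abszE ger0_norm ?subr_ge0 //.
move: hx1 hx2; case: (leP a b) => h hx1 hx2.
  by rewrite ger0_norm ?subr_ge0 // lerD2r.
by rewrite ltr0_norm ?subr_lt0 // opprB lerD2r.
Qed.

Lemma mem_rect (c d e : cell) :
  (e \in rect c d) =
    (Num.min c.1 d.1 <= e.1 <= Num.max c.1 d.1) &&
    (Num.min c.2 d.2 <= e.2 <= Num.max c.2 d.2).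
Proof.
rewrite -!mem_int_range; case: e => x y /=.
apply/imfset2P/andP => [[u hu [v hv [-> ->]]] //|[hx hy]].
by exists x => //; exists y.
Qed.

(* The value true stands for a 1. *)
Notation filling T := {ffun T -> bool}.

Definition ascent (T : polyomino) (F : filling T) (c d : T) : bool :=
  [&& F c, F d, (val c).1 < (val d).1, (val c).2 < (val d).2
    & rect (val c) (val d) `<=` T].

Definition descent (T : polyomino) (F : filling T) (c d : T) : bool :=
  [&& F c, F d, (val c).1 < (val d).1, (val d).2 < (val c).2
    & rect (val c) (val d) `<=` T].

Definition ne2 (T : polyomino) (F : filling T) : nat :=
  #|[set cd : T * T | ascent F cd.1 cd.2]|.

Definition se2 (T : polyomino) (F : filling T) : nat :=
  #|[set cd : T * T | descent F cd.1 cd.2]|.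

(* At most one 1 in each column, respectively in each row. *)
Definition fillings_c (T : polyomino) : {set filling T} :=
  [set F : filling T | [forall c, forall d,
    [&& F c, F d & (val c).1 == (val d).1] ==> (c == d)]].

Definition fillings_r (T : polyomino) : {set filling T} :=
  [set F : filling T | [forall c, forall d,
    [&& F c, F d & (val c).2 == (val d).2] ==> (c == d)]].

Definition fillings_rc (T : polyomino) : {set filling T} :=
  fillings_c T :&: fillings_r T.

(* Main.v *)
(* In the intersection-free shape the rows have nested column sets, and by column
   convexity the shorter of the top and the bottom row has its column set C
   contained in that of every row.  Let U be the set of nonempty columns and X the
   subset of U :&: C holding the 1s of that row.  Each 1 of the row, together with
   the 1 of any column in (U :&: C) :\: X, spans a rectangle inside the shape; as the
   row is extremal, whether this chain is an ascent or a descent depends only on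
   which of the two columns is to the left.  An order-reversing bijection of U :&: C
   therefore exchanges the two statistics of the row, and removing the row leaves the
   nonempty columns U :\: X.  Fillings with at most one 1 per row follow by
   transposition. *)

Require Import Defs.
From mathcomp Require Import all_boot all_order all_algebra.
From mathcomp Require Import finmap zify.

Set Implicit Arguments.
Unset Strict Implicit.
Unset Printing Implicit Defensive.

Import GRing.Theory.

(** * Order reversals and inversions between sets of columns *)

Lemma index_enum_ltn n (V : {set 'I_n}) (x y : 'I_n) : x \in V -> y \in V ->
  (index x (enum V) < index y (enum V)) = (x < y).
Proof.
have srt : sorted ltn (map val (enum V)).
  apply: (subseq_sorted ltn_trans (s2 := map val (enum 'I_n))); last first.
    by rewrite val_enum_ord iota_ltn_sorted.
  by apply: map_subseq; rewrite enumT; apply: filter_subseq.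
move=> xV yV.
suff lt_mono a b : a \in V -> b \in V -> a < b -> index a (enum V) < index b (enum V).
  case: (ltngtP x y) => [|xy|/val_inj ->]; first exact: lt_mono.
    by apply/negbTE; rewrite -leqNgt ltnW // lt_mono.
  by rewrite ltnn.
move=> aV bV ab; rewrite ltnNge; apply/negP => le_ba.
have := sorted_leq_nth leq_trans leqnn 0 (sub_sorted (@ltnW) srt).
move=> /(_ (index b (enum V)) (index a (enum V))).
rewrite !inE size_map !index_mem !mem_enum => /(_ bV aV le_ba).
rewrite !(nth_map a) ?index_mem ?mem_enum // !nth_index ?mem_enum //.
by rewrite leqNgt ab.
Qed.

(** The increasing list of [V], then its complement, is matched position by position with the
    decreasing list of [V'], then its complement. Making [phi] injective on all of ['I_n] allows it
    to reindex sums over arbitrary subsets and pairs. *)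
Lemma order_reversing_injection n (V V' : {set 'I_n}) : #|V| = #|V'| ->
  exists phi : 'I_n -> 'I_n,
    [/\ injective phi, forall x, (phi x \in V') = (x \in V) &
        {in V &, forall x y, (phi x < phi y) = (y < x)}].
Proof.
move=> cVV'.
pose e := enum V ++ enum (~: V); pose e' := rev (enum V') ++ enum (~: V').
have cCVV' : #|~: V| = #|~: V'|.
  by apply/eqP; rewrite -(eqn_add2l #|V|) {2}cVV' !cardsC.
have sz : size e = size e' by rewrite !size_cat size_rev -!cardE cVV' cCVV'.
have mem_e x : x \in e by rewrite mem_cat !mem_enum inE orbN.
have uniq_e' : uniq e'.
  rewrite cat_uniq rev_uniq !enum_uniq andbT /=.
  by apply/hasPn => x; rewrite mem_enum inE mem_rev mem_enum.
(* The default [x] is never reached, since [e] lists every element and [e'] has the same length. *)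
pose phi x := nth x e' (index x e).
have lt_e x : index x e < size e' by rewrite -sz index_mem.
have phi_in x : x \in V -> phi x = nth x (enum V') (#|V| - (index x (enum V)).+1).
  move=> xV; rewrite /phi /e /e' index_cat mem_enum xV nth_cat size_rev -cardE -cVV'.
  have lt_x : index x (enum V) < #|V| by rewrite cardE index_mem mem_enum.
  by rewrite lt_x nth_rev -cardE -cVV'.
have idx_phi x : x \in V -> (phi x \in V') /\
    index (phi x) (enum V') = #|V| - (index x (enum V)).+1.
  move=> xV; rewrite phi_in //.
  have lt_x : index x (enum V) < #|V| by rewrite cardE index_mem mem_enum.
  have lt_y : #|V| - (index x (enum V)).+1 < size (enum V').
    by rewrite -cardE -cVV'; lia.
  by rewrite -mem_enum mem_nth // index_uniq ?enum_uniq.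
exists phi; split.
- move=> x y; rewrite /phi (set_nth_default y x) // => /eqP.
  by rewrite nth_uniq // => /eqP /(congr1 (nth x e)); rewrite !nth_index.
- move=> x; case: (boolP (x \in V)) => xV; first by case: (idx_phi x xV).
  suff : phi x \in enum (~: V') by rewrite mem_enum inE => /negbTE.
  rewrite /phi /e /e' index_cat mem_enum (negbTE xV).
  rewrite nth_cat size_rev -!cardE cVV' ltnNge leq_addr /= addKn.
  by apply: mem_nth; rewrite -cardE -cCVV' cardE index_mem mem_enum inE.
- move=> x y xV yV; case: (idx_phi x xV) (idx_phi y yV) => px ix [py iy].
  rewrite -(index_enum_ltn px py) ix iy -(index_enum_ltn yV xV).
  have : index x (enum V) < #|V| by rewrite cardE index_mem mem_enum.
  have : index y (enum V) < #|V| by rewrite cardE index_mem mem_enum.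
  by move: #|V| (index x _) (index y _) => k i j; lia.
Qed.

Definition crossings n (A B : {set 'I_n}) : nat :=
  \sum_(z : 'I_n * 'I_n) [&& z.1 < z.2, z.1 \in A & z.2 \in B].

Lemma crossings_reversal n (V : {set 'I_n}) (phi : 'I_n -> 'I_n) :
  injective phi -> {in V &, forall x y, (phi x < phi y) = (y < x)} ->
  forall A B : {set 'I_n}, A \subset V -> B \subset V ->
  crossings (phi @: A) (phi @: B) = crossings B A.
Proof.
move=> phi_inj phi_lt A B /subsetP AV /subsetP BV.
(* The two entries of a pair are swapped as well, so that the reversed pair is again increasing. *)
rewrite /crossings (reindex_inj (h := fun z => (phi z.2, phi z.1))) /=; last first.
  by move=> [x y] [x' y'] /= [/phi_inj -> /phi_inj ->].
apply: eq_bigr => -[x y] _ /=; rewrite !mem_imset //.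
case yA: (y \in A); case xB: (x \in B); rewrite ?andbF // phi_lt //.
  exact: AV.
exact: BV.
Qed.

(** * Fillings as partial maps on columns, and the effect of adding a row *)

Section ColumnFillings.

(* [M x l] says that the cell of column [x] and row [l] belongs to the shape; [cap]
   encodes the condition on the number of 1s in a row.  A filling with at most one 1
   per column maps each column to the row of its 1, or to [None]. *)
Variables (n : nat) (M : rel 'I_n) (cap : pred nat).
Implicit Types (f g : {ffun 'I_n -> option 'I_n}) (U V X S : {set 'I_n}).

Definition row_support (l : 'I_n) : {set 'I_n} := [set x | M x l].

Definition fiber f (l : 'I_n) : {set 'I_n} := [set x | f x == Some l].

(** [U] is exactly the set of nonempty columns, not just a bound for it: the number of chains
    through an extremal row can then be read off from the 1s of that row. *)
Definition fits S U f : bool :=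
  [forall x, if f x is Some l then [&& x \in U, l \in S & M x l] else x \notin U].

Definition capped f : bool := [forall l, cap #|fiber f l|].

(** The last two conjuncts concern the other two corners of the rectangle; in a convex shape they
    amount to the whole rectangle, by [rect_subset]. *)
Definition chain (up : bool) f (z : 'I_n * 'I_n) : bool :=
  if (f z.1, f z.2) is (Some l, Some l')
  then [&& z.1 < z.2, if up then l < l' else l' < l, M z.1 l' & M z.2 l] else false.

Definition chains up f : nat := \sum_z chain up f z.

Definition add_row (l : 'I_n) X g : {ffun 'I_n -> option 'I_n} :=
  [ffun x => if x \in X then Some l else g x].

Definition del_row (l : 'I_n) f : {ffun 'I_n -> option 'I_n} :=
  [ffun x => if f x == Some l then None else f x].

Lemma fitsP S U f :
  reflect (forall x, if f x is Some l then [&& x \in U, l \in S & M x l] else x \notin U)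
    (fits S U f).
Proof. exact: forallP. Qed.

Lemma fiber_add_row l l' X g : {in X, forall x, g x = None} -> l' != l ->
  fiber (add_row l X g) l' = fiber g l'.
Proof.
move=> gX l'l; apply/setP => x; rewrite !inE ffunE.
by case: ifP => // xX; rewrite gX //; apply/eqP => -[] ll'; rewrite ll' eqxx in l'l.
Qed.

(** The left side is the condition that [reindex_onto] produces when the fillings with row [l] equal
    to [X] are parametrised by what remains after deleting that row. *)
Lemma add_rowK l S U X g : l \notin S -> X \subset U :&: row_support l ->
  cap #|X| -> cap 0 ->
  [&& fits (l |: S) U (add_row l X g) && capped (add_row l X g),
    fiber (add_row l X g) l == X & del_row l (add_row l X g) == g] =
  fits S (U :\: X) g && capped g.
Proof.
move=> lS /subsetP XU capX cap0; apply/idP/idP.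
- case/and3P => /andP[/fitsP fitU capU] _ /eqP delX.
  have gX x : x \in X -> g x = None by move=> xX; rewrite -delX !ffunE xX eqxx.
  have gl x : g x != Some l by rewrite -delX ffunE; case: ifP => // /negbT.
  apply/andP; split.
    apply/fitsP => x; have := fitU x; rewrite ffunE.
    case: ifP => xX; first by rewrite gX // !inE xX.
    case gx: (g x) => [l'|]; rewrite !inE xX //=.
    by have := gl x; rewrite gx; case: (eqVneq l' l) => [->|//]; rewrite eqxx.
  (* Row [l] of [g] is empty, which [cap0] permits. *)
  apply/forallP => l'; have [->|l'l] := eqVneq l' l.
    suff -> : fiber g l = set0 by rewrite cards0.
    by apply/setP => x; rewrite !inE (negbTE (gl x)).
  by move/forallP/(_ l'): capU; rewrite fiber_add_row.
- case/andP => /fitsP fitU /forallP capU.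
  have gX x : x \in X -> g x = None.
    by move=> xX; have := fitU x; case: (g x) => // l'; rewrite inE xX.
  have gl x : g x != Some l.
    apply/eqP => gx; have := fitU x; rewrite gx => /and3P[_ ls _].
    by rewrite ls in lS.
  have fibl : fiber (add_row l X g) l = X.
    by apply/setP => x; rewrite !inE ffunE; case: (x \in X); rewrite ?eqxx ?(negbTE (gl x)).
  rewrite fibl eqxx /=; apply/andP; split; last first.
    apply/eqP/ffunP => x; rewrite !ffunE.
    by case xX: (x \in X); [rewrite eqxx gX | rewrite (negbTE (gl x))].
  apply/andP; split.
    apply/fitsP => x; have := fitU x; rewrite ffunE.
    case: ifP => xX; first by move=> _; have := XU x xX; rewrite !inE eqxx => /andP[-> ->].
    by case: (g x) => [l'|]; rewrite !inE xX //= => /and3P[-> -> ->]; rewrite orbT.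
  apply/forallP => l'; have [->|l'l] := eqVneq l' l; first by rewrite fibl.
  by rewrite fiber_add_row.
Qed.

(** A new chain joins a 1 in row [l], column [x], to a 1 of [g] in row [l'], column [y]. The corner
    in column [x] and row [l'] is present because row [l] is contained in row [l']; the corner in
    column [y] and row [l] is present exactly when [y] lies in [row_support l]. The case
    [above == up] is the one where the 1 of row [l] is on the right. *)
Lemma chains_add_row (l : 'I_n) S U X g (above up : bool) :
  (forall l', l' \in S -> if above then l' < l else l < l') ->
  (forall l', l' \in S -> row_support l \subset row_support l') ->
  X \subset U :&: row_support l -> fits S (U :\: X) g ->
  chains up (add_row l X g) =
  chains up g + if above == up then crossings ((U :&: row_support l) :\: X) X
                else crossings X ((U :&: row_support l) :\: X).
Proof.
move=> lt_l sub_l /subsetP XU /fitsP fitU.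
have gX x : x \in X -> g x = None.
  by move=> xX; have := fitU x; case: (g x) => // l'; rewrite inE xX.
have colX x : x \in X -> M x l by move=> /XU; rewrite !inE => /andP[].
have MX x l' : l' \in S -> M x l -> M x l'.
  by move=> l'S xl; have /subsetP/(_ x) := sub_l _ l'S; rewrite !inE => ->.
rewrite /chains /crossings.
have if_sum (b : bool) (F G : 'I_n * 'I_n -> nat) :
  (if b then \sum_z F z else \sum_z G z) = \sum_z (if b then F z else G z) by case: b.
rewrite if_sum -big_split; apply: eq_bigr => -[x y] _ /=.
rewrite /chain /= !ffunE !inE.
have fx := fitU x; have fy := fitU y.
case xX: (x \in X); case yX: (y \in X) => /=.
- by rewrite !gX //= !ltnn !andbF !if_same andbF.
- rewrite (gX x) ?andbF //=; case: (g y) fy => [l'|]; rewrite !inE yX /=; last first.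
    by move/negbTE ->; rewrite andbF if_same.
  case/and3P => -> l'S _; have := lt_l _ l'S; rewrite (MX x) ?(colX x) //=.
  by case: above {lt_l}; case: up => /= lt1; rewrite ?lt1 ?[l < l']ltnNge ?[l' < l]ltnNge ?(ltnW lt1) /= ?andbT ?andbF.
- rewrite (gX y) //=; case: (g x) fx => [l'|]; rewrite !inE xX /=; last first.
    by move/negbTE ->; rewrite !andbF if_same.
  case/and3P => -> l'S _; have := lt_l _ l'S; rewrite (MX y) ?(colX y) //=.
  by case: above {lt_l}; case: up => /= lt1; rewrite ?lt1 ?[l < l']ltnNge ?[l' < l]ltnNge ?(ltnW lt1) /= ?andbT ?andbF.
- by rewrite !andbF if_same addn0.
Qed.

(** * Weighted sums and induction on the rows *)

Variables (R : comNzRingType) (p q : R).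
Hypothesis cap0 : cap 0.

Definition weight f : R := (p ^+ chains true f * q ^+ chains false f)%R.
Definition weight_swap f : R := (p ^+ chains false f * q ^+ chains true f)%R.

(** The invariant of the induction: it is exactly what is needed to match the two column sets inside
    any row of [S] that is removed next. *)
Definition equinumerous S U U' : Prop :=
  #|U| = #|U'| /\ (forall l, l \in S -> #|U :&: row_support l| = #|U' :&: row_support l|).

(* Two different sets of nonempty columns are compared because removing a row from two
   fillings matched by an order reversal leaves the different sets [U :\: X] and
   [U' :\: phi @: X]. *)
Definition chain_symmetric S : Prop := forall U U', equinumerous S U U' ->
  (\sum_(f | fits S U f && capped f) weight f =
   \sum_(f | fits S U' f && capped f) weight_swap f)%R.

(** The fillings are grouped by the set [X] of columns whose 1 lies in row [l], and that row is then
    deleted from each group. *)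
Lemma sum_add_row l S U (P : {ffun 'I_n -> option 'I_n} -> R) : l \notin S ->
  (\sum_(f | fits (l |: S) U f && capped f) P f =
   \sum_(X : {set 'I_n} | (X \subset U :&: row_support l) && cap #|X|)
     \sum_(g | fits S (U :\: X) g && capped g) P (add_row l X g))%R.
Proof.
move=> lS; rewrite (partition_big (fiber^~ l)
  (fun X => (X \subset U :&: row_support l) && cap #|X|)) /=; last first.
  move=> f /andP[/fitsP fitU /forallP capU]; rewrite capU andbT.
  apply/subsetP => x; rewrite !inE => /eqP fx.
  by have := fitU x; rewrite fx => /and3P[-> _ ->].
apply: eq_bigr => X /andP[XU capX].
rewrite (reindex_onto (add_row l X) (del_row l)) /=; last first.
  move=> f /andP[_ /eqP <-]; apply/ffunP => x; rewrite !ffunE inE.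
  by case: eqP.
by apply: eq_bigl => g; rewrite -andbA add_rowK.
Qed.

Lemma chain_symmetric_add_row (above : bool) (l : 'I_n) S :
  (forall l', l' \in S -> if above then l' < l else l < l') ->
  (forall l', l' \in S -> row_support l \subset row_support l') ->
  chain_symmetric S -> chain_symmetric (l |: S).
Proof.
move=> lt_l sub_l IH U U' [cardU eqU].
have lS : l \notin S.
  by apply/negP => /lt_l; rewrite ltnn if_same.
have [phi [phi_inj phi_in phi_lt]] := order_reversing_injection (eqU l (setU11 _ _)).
set V := U :&: row_support l in phi_in phi_lt; set V' := U' :&: row_support l in phi_in.
have sub_phi X : (phi @: X \subset V') = (X \subset V).
  apply/subsetP/subsetP => sub x; first by move=> xX; rewrite -phi_in sub ?imset_f.
  by case/imsetP => y yX ->; rewrite phi_in sub.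
have phiV : phi @: V = V'.
  apply/eqP; rewrite eqEcard sub_phi subxx card_imset //.
  by rewrite /V /V' eqU ?setU11 /=.
rewrite !sum_add_row // [RHS](reindex_inj (imset_inj phi_inj)) /=.
apply: eq_big => [X|X /andP[XV capX]]; first by rewrite -/V -/V' sub_phi card_imset.
have XU : X \subset U by rewrite (subset_trans XV) ?subsetIl.
have XU' : phi @: X \subset U' by rewrite (subset_trans (B := V')) ?sub_phi ?subsetIl.
(* [c b] counts the chains of direction [b] that pass through row [l]. *)
pose c b := if above == b then crossings (V :\: X) X else crossings X (V :\: X).
transitivity (p ^+ c true * q ^+ c false *
    \sum_(g | fits S (U :\: X) g && capped g) weight g)%R.
  rewrite mulr_sumr; apply: eq_bigr => g /andP[fitg _].
  rewrite /weight !(chains_add_row _ lt_l sub_l XV fitg) !exprD -/V.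
  by rewrite mulrACA [LHS]mulrC.
(* Under the reversal the 1s of row [l] move to the other side of their partners, so ascents and
   descents through the row trade places. *)
have c' b : (if above == b then crossings (V' :\: phi @: X) (phi @: X)
   else crossings (phi @: X) (V' :\: phi @: X)) = c (~~ b).
  have -> : V' :\: phi @: X = phi @: (V :\: X).
    rewrite -phiV; apply/setP => y; apply/setDP/imsetP => [[/imsetP[x xV ->]]|[x]].
      by rewrite mem_imset // => xX; exists x => //; apply/setDP.
    by rewrite inE => /andP[xX xV] ->; rewrite !mem_imset.
  rewrite /c !(crossings_reversal phi_inj phi_lt) ?subsetDl //.
  by case: (above) b => -[].
(* The invariant survives: [X] and [phi @: X] lie in row [l], hence in every row of [S], so each
   intersection loses the same [#|X|] columns. *)
rewrite (IH _ (U' :\: phi @: X)); last first.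
  split=> [|l' l'S]; rewrite ?setIDAC ?cardsD.
    by rewrite cardU (setIidPr XU) (setIidPr XU') card_imset.
  rewrite eqU ?setU1r //; congr (_ - _).
  have XC : X \subset U :&: row_support l'.
    by rewrite subsetI XU (subset_trans XV) // (subset_trans (subsetIr _ _)) ?sub_l.
  have XC' : phi @: X \subset U' :&: row_support l'.
    rewrite subsetI XU' (subset_trans (B := V')) ?sub_phi //.
    by rewrite (subset_trans (subsetIr _ _)) ?sub_l.
  by rewrite (setIidPr XC) (setIidPr XC') card_imset.
rewrite mulr_sumr; apply: eq_bigr => g /andP[fitg _].
have XV' : phi @: X \subset V' by rewrite sub_phi.
rewrite /weight_swap !(chains_add_row _ lt_l sub_l XV' fitg) !exprD -/V' !c'.
by rewrite [LHS]mulrC [RHS]mulrACA.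
Qed.

Hypothesis col_convex : forall (x a b c : 'I_n), a <= b <= c -> M x a -> M x c -> M x b.
Hypothesis nested : forall a b : 'I_n,
  row_support a \subset row_support b \/ row_support b \subset row_support a.

(** Either end of the block of rows may be the one to remove, so the induction runs over intervals
    with an arbitrary lower end. *)
Lemma chain_symmetric_interval (lo m : nat) : lo + m <= n ->
  chain_symmetric [set l : 'I_n | lo <= l < lo + m].
Proof.
elim: m lo => [|m IH] lo lo_m.
  have -> : [set l : 'I_n | lo <= l < lo + 0] = set0.
    by apply/setP => l; rewrite !inE; apply/negbTE; lia.
  (* Without rows only the empty filling is left, and only for empty [U]; equal cardinality makes
     this the same condition for [U']. *)
  have fits0 U f : fits set0 U f = (U == set0) && (f == [ffun=> None]).
    apply/fitsP/andP => [fitU|[/eqP -> /eqP ->] x]; last by rewrite ffunE inE.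
    have f0 x : f x = None.
      by have := fitU x; case: (f x) => // l; rewrite in_set0 /= andbF.
    split; last by apply/eqP/ffunP => x; rewrite ffunE f0.
    by rewrite -subset0; apply/subsetP => x; have := fitU x; rewrite f0 => /negbTE ->.
  move=> U U' [cardU _]; apply: eq_big => [f|f /andP[]].
    by rewrite !fits0 -!cards_eq0 cardU.
  rewrite fits0 => /andP[_ /eqP ->] _.
  suff c0 b : chains b [ffun=> None] = 0 by rewrite /weight /weight_swap !c0.
  by apply: big1 => z _; rewrite /chain !ffunE.
have lt_top : lo + m < n by rewrite addnS in lo_m.
have lt_lo : lo < n by lia.
pose top := Ordinal lt_top; pose bot := Ordinal lt_lo.
have [sub|sub] := nested top bot.
- have -> : [set l : 'I_n | lo <= l < lo + m.+1] = top |: [set l : 'I_n | lo <= l < lo + m].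
    by apply/setP => l; rewrite !inE -(inj_eq val_inj) /=; lia.
  apply: (chain_symmetric_add_row (above := true)) => [l'|l'|]; last exact/IH/ltnW.
    by rewrite inE /= => /andP[].
  (* A column meeting the top row also meets the bottom row, hence by convexity every row between
     them. *)
  rewrite inE => /andP[lo_l l_top]; apply/subsetP => x xt.
  have := xt; move/(subsetP sub): xt; rewrite !inE; apply: col_convex.
  by rewrite /= lo_l ltnW.
- have -> : [set l : 'I_n | lo <= l < lo + m.+1] =
      bot |: [set l : 'I_n | lo.+1 <= l < lo.+1 + m].
    by apply/setP => l; rewrite !inE -(inj_eq val_inj) /=; lia.
  apply: (chain_symmetric_add_row (above := false)) => [l'|l'|]; last first.
  + by apply: IH; lia.
  + rewrite inE => /andP[lo_l l_top]; apply/subsetP => x xb.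
    have := subsetP sub x xb; move: xb; rewrite !inE; apply: col_convex => /=; lia.
  + by rewrite inE /= => /andP[].
Qed.

Definition inside f : bool := [forall x, if f x is Some l then M x l else true].

(** The sum splits by the set of nonempty columns, and each part is the case [U' = U] of
    [chain_symmetric]. *)
Lemma column_fillings_symmetric :
  (\sum_(f | inside f && capped f) weight f =
   \sum_(f | inside f && capped f) weight_swap f)%R.
Proof.
pose full := [set l : 'I_n | 0 <= l < 0 + n].
have sym : chain_symmetric full by apply: chain_symmetric_interval.
pose supp (f : {ffun 'I_n -> option 'I_n}) := [set x | f x != None].
have fitsE U f : inside f && capped f && (supp f == U) = fits full U f && capped f.
  rewrite andbAC; congr (_ && _); apply/andP/fitsP.
    case=> /forallP fM /eqP <- x; have := fM x; rewrite !inE.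
    by case: (f x) => // l ->; rewrite inE /= ltn_ord.
  move=> fitU; split; first by apply/forallP => x; have := fitU x; case: (f x) => // l /and3P[].
  apply/eqP/setP => x; have := fitU x; rewrite inE.
  by case: (f x) => [l /and3P[->]|/negbTE ->].
rewrite (partition_big supp xpredT) //= [RHS](partition_big supp xpredT) //=.
apply: eq_bigr => U _; rewrite !(eq_bigl _ _ (fitsE U)); exact: sym.
Qed.

End ColumnFillings.

(** * From column maps back to 01-fillings of cells *)

Section EncodedFillings.

Variables (T : finType) (n : nat) (enc : T -> 'I_n * 'I_n).
Hypothesis enc_inj : injective enc.
Implicit Types (F : {ffun T -> bool}) (f : {ffun 'I_n -> option 'I_n}).

(** Everything depends on the shape through [enc] alone, so transposing the shape means swapping the
    two coordinates of [enc]. *)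
Definition cell_at : rel 'I_n := fun x l => (x, l) \in codom enc.

Definition cell_chain up F (c d : T) : bool :=
  [&& F c, F d, (enc c).1 < (enc d).1,
      (if up then (enc c).2 < (enc d).2 else (enc d).2 < (enc c).2),
      cell_at (enc c).1 (enc d).2 & cell_at (enc d).1 (enc c).2].

Definition cell_chains up F : nat := #|[set cd : T * T | cell_chain up F cd.1 cd.2]|.

Definition one_per_col F : bool :=
  [forall c, forall d, [&& F c, F d & (enc c).1 == (enc d).1] ==> (c == d)].

Definition one_per_row F : bool :=
  [forall c, forall d, [&& F c, F d & (enc c).2 == (enc d).2] ==> (c == d)].

Definition filling_of f : {ffun T -> bool} := [ffun c => f (enc c).1 == Some (enc c).2].

Definition column_filling F : {ffun 'I_n -> option 'I_n} :=
  [ffun x => omap (fun c => (enc c).2) [pick c | F c & (enc c).1 == x]].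

Lemma one_per_colP F :
  reflect (forall c d, F c -> F d -> (enc c).1 = (enc d).1 -> c = d) (one_per_col F).
Proof.
apply: (iffP forallP) => [free c d Fc Fd cd|free c].
  by have /forallP/(_ d) := free c; rewrite Fc Fd cd eqxx => /eqP.
by apply/forallP => d; apply/implyP => /and3P[Fc Fd /eqP cd]; apply/eqP; apply: free.
Qed.

Lemma one_per_rowP F :
  reflect (forall c d, F c -> F d -> (enc c).2 = (enc d).2 -> c = d) (one_per_row F).
Proof.
apply: (iffP forallP) => [free c d Fc Fd cd|free c].
  by have /forallP/(_ d) := free c; rewrite Fc Fd cd eqxx => /eqP.
by apply/forallP => d; apply/implyP => /and3P[Fc Fd /eqP cd]; apply/eqP; apply: free.
Qed.

Lemma inside_cellsP f :
  reflect (forall x l, f x = Some l -> exists c, enc c = (x, l)) (inside cell_at f).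
Proof.
apply: (iffP forallP) => [ins x l fx|ins x].
  by have := ins x; rewrite fx => /codomP[c ->]; exists c.
case fx: (f x) => [l|//]; have [c ec] := ins x l fx.
by rewrite /cell_at -ec codom_f.
Qed.

Lemma column_fillingK F : one_per_col F -> filling_of (column_filling F) = F.
Proof.
move/one_per_colP => free; apply/ffunP => c; rewrite !ffunE.
case: pickP => [d /andP[Fd /eqP dc]|none] /=.
  apply/eqP/idP => [[dc2]|Fc]; last by rewrite (free d c).
  have <- // : d = c by apply: enc_inj; move: dc dc2; case: (enc d) (enc c) => ? ? [? ?] /= -> ->.
by have := none c; rewrite eqxx andbT => ->.
Qed.

Lemma filling_ofK f : inside cell_at f -> column_filling (filling_of f) = f.
Proof.
move/inside_cellsP => ins; apply/ffunP => x; rewrite ffunE.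
case: pickP => [d|none] /=; first by rewrite ffunE => /andP[/eqP fd /eqP <-].
case fx: (f x) => [l|//]; have [c ec] := ins x l fx.
by have := none c; rewrite ffunE ec /= fx !eqxx.
Qed.

Lemma inside_column_filling F : inside cell_at (column_filling F).
Proof.
apply/inside_cellsP => x l; rewrite ffunE; case: pickP => //= c /andP[_ /eqP cx] [cl].
by exists c; rewrite -cx -cl; case: (enc c).
Qed.

Lemma one_per_col_filling_of f : one_per_col (filling_of f).
Proof.
apply/one_per_colP => c d; rewrite !ffunE => /eqP fc /eqP fd cd; apply: enc_inj.
by move: fc fd cd; case: (enc c) (enc d) => [x l] [x' l'] /= fx fx' xx'; move: fx; rewrite xx' fx' => -[->].
Qed.

Lemma one_per_row_filling_of f : inside cell_at f ->
  one_per_row (filling_of f) = [forall l, #|fiber f l| <= 1].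
Proof.
move/inside_cellsP => ins; apply/one_per_rowP/forallP => [free l|le1 c d].
  apply/card_le1_eqP => x y; rewrite !inE => /eqP fx /eqP fy.
  have [[c ec] [d ed]] := (ins _ _ fx, ins _ _ fy).
  have cd : c = d by apply: free; rewrite ?ffunE ?ec ?ed //= ?fx ?fy eqxx.
  by move: ec; rewrite cd ed => -[].
rewrite !ffunE => fc fd cd; apply: enc_inj.
have /card_le1_eqP/(_ (enc c).1 (enc d).1) := le1 (enc c).2.
rewrite !inE fc cd fd => /(_ isT isT).
by move: cd; case: (enc c) (enc d) => ? ? [? ?] /= -> ->.
Qed.

(** A column holds at most one 1, so a chain is determined by its pair of columns. *)
Lemma cell_chains_filling_of up f : inside cell_at f ->
  cell_chains up (filling_of f) = chains cell_at up f.
Proof.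
move/inside_cellsP => ins.
pose pi (cd : T * T) := ((enc cd.1).1, (enc cd.2).1).
rewrite /cell_chains /chains -(card_in_imset (f := pi)); last first.
  move=> [c d] [c' d']; rewrite !inE /cell_chain /= => /and3P[Fc Fd _] /and3P[Fc' Fd' _].
  have /one_per_colP free := one_per_col_filling_of f.
  move=> /= cd'; congr pair; [apply: (free c c')|apply: (free d d')] => //;
  by have := congr1 fst cd'; have := congr1 snd cd'.
set A := [set cd | _].
have inA z : (z \in pi @: A) = chain cell_at up f z.
  case: z => x y; apply/imsetP/idP => [[[c d]]|].
    rewrite inE /cell_chain /= !ffunE => /and5P[/eqP fc /eqP fd lt1 lt2 /andP[s1 s2]] -[-> ->].
    by rewrite /chain /= fc fd lt1 lt2 s1 s2.
  rewrite /chain /=; case fx: (f x) => [l|//]; case fy: (f y) => [l'|//] /and4P[lt1 lt2 s1 s2].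
  have [[c ec] [d ed]] := (ins _ _ fx, ins _ _ fy).
  exists (c, d); last by rewrite /pi /= ec ed.
  by rewrite inE /cell_chain /= !ffunE ec ed /= fx fy !eqxx lt1 lt2 s1 s2.
rewrite -sum1_card big_mkcond; apply: eq_bigr => z _; rewrite inA.
by case: (chain _ _ _ _).
Qed.

(** The flag switches the row condition on or off; it becomes a bound on fiber sizes through
    [cap]. *)
Lemma encoded_fillings_symmetric (only_rows : bool) (R : comNzRingType) (p q : R) :
  (forall (x a b c : 'I_n), a <= b <= c -> cell_at x a -> cell_at x c -> cell_at x b) ->
  (forall a b : 'I_n,
     row_support cell_at a \subset row_support cell_at b \/ row_support cell_at b \subset row_support cell_at a) ->
  (\sum_(F | one_per_col F && (only_rows ==> one_per_row F))
     p ^+ cell_chains true F * q ^+ cell_chains false F =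
   \sum_(F | one_per_col F && (only_rows ==> one_per_row F))
     p ^+ cell_chains false F * q ^+ cell_chains true F)%R.
Proof.
move=> conv nest.
pose cap k := only_rows ==> (k <= 1).
have cap0 : cap 0 by rewrite /cap implybT.
have sym := column_fillings_symmetric p q cap0 conv nest.
have dom f : one_per_col (filling_of f) && (only_rows ==> one_per_row (filling_of f)) &&
    (column_filling (filling_of f) == f) = inside cell_at f && capped cap f.
  rewrite one_per_col_filling_of /=.
  have [ins|nins] := boolP (inside cell_at f); last first.
    apply/negbTE; rewrite negb_and; apply/orP; right; apply: contraNneq nins => <-.
    exact: inside_column_filling.
  rewrite filling_ofK // eqxx andbT one_per_row_filling_of // /capped /cap /=.
  case: (only_rows) => //=; apply/esym/forallP => ?; exact: implyFb.
have onto F : one_per_col F && (only_rows ==> one_per_row F) ->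
    filling_of (column_filling F) = F.
  by case/andP => /column_fillingK.
rewrite !(reindex_onto filling_of column_filling onto) !(eq_bigl _ _ dom).
transitivity (\sum_(f | inside cell_at f && capped cap f) weight cell_at p q f)%R.
  by apply: eq_bigr => f /andP[ins _]; rewrite /weight -!cell_chains_filling_of.
rewrite sym; apply: eq_bigr => f /andP[ins _].
by rewrite /weight_swap -!cell_chains_filling_of.
Qed.

End EncodedFillings.

(** * Moon polyominoes in ordinal coordinates *)

Local Open Scope ring_scope.

(** Column convexity fills the two vertical sides, then row convexity fills each row between
    them. *)
Lemma rect_subset (T : polyomino) (c d : cell) : convex T -> c \in T -> d \in T ->
  (rect c d `<=` T)%fset = ((c.1, d.2) \in T) && ((d.1, c.2) \in T).
Proof.
case: c d => [x1 y1] [x2 y2] [row_conv col_conv] cT dT /=.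
apply/fsubsetP/andP => [sub|[cdT dcT] [x y]].
  by split; apply: sub; rewrite mem_rect /=; lia.
rewrite mem_rect /= => /andP[xr yr].
have col_mem z : (z, y1) \in T -> (z, y2) \in T -> (z, y) \in T.
  move=> z1 z2; have [y12|y12] : y1 <= y2 \/ y2 <= y1 by lia.
    by apply: (col_conv z y1 y y2); rewrite ?inE //; lia.
  by apply: (col_conv z y2 y y1); rewrite ?inE //; lia.
have [xy1 xy2] := (col_mem x1 cT cdT, col_mem x2 dcT dT).
have [x12|x12] : x1 <= x2 \/ x2 <= x1 by lia.
  by apply: (row_conv y x1 x x2); rewrite ?inE //; lia.
by apply: (row_conv y x2 x x1); rewrite ?inE //; lia.
Qed.

Lemma ordinal_coordinates (T : polyomino) :
  exists n (s : int) (enc : T -> 'I_n * 'I_n), forall c : T,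
    ((enc c).1 : nat)%:Z = (val c).1 + s /\ ((enc c).2 : nat)%:Z = (val c).2 + s.
Proof.
pose N := (\sum_(c : T) (`|(val c).1|%N + `|(val c).2|%N))%N.
have leN (c : T) : (`|(val c).1| + `|(val c).2| <= N)%N.
  by rewrite /N (bigD1 c) //= leq_addr.
(* All coordinates lie between [-N] and [N]; shifted by [N] they stay below [(N + N).+1], so [inord]
   never returns its default. *)
exists (N + N).+1, N%:Z,
  (fun c : T => (inord `|(val c).1 + N%:Z|, inord `|(val c).2 + N%:Z|)) => c /=.
have := leN c; move: (val c).1 (val c).2 N {leN} => x y N leN.
by rewrite !inordK; lia.
Qed.

Theorem theorem2p1 (T : polyomino) (hT : moon_polyomino T)
    (B : {set filling T})
    (hB : B = fillings_rc T \/ B = fillings_c T \/ B = fillings_r T)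
    (R : comNzRingType) (p q : R) :
  \sum_(F in B) p ^+ ne2 F * q ^+ se2 F = \sum_(F in B) p ^+ se2 F * q ^+ ne2 F.
Proof.
case: hT => conv free; have [n [s [enc encE]]] := ordinal_coordinates T.
(* The transposed shape, used for fillings with at most one 1 per row. *)
pose enc' (c : T) := ((enc c).2, (enc c).1).
have enc_inj : injective enc.
  move=> c d cd; apply: val_inj; have := encE c; have := encE d; rewrite cd.
  by case: (val c) (val d) => [x y] [x' y'] /= [-> ->] [/addIr -> /addIr ->].
have enc'_inj : injective enc'.
  by move=> c d [e2 e1]; apply: enc_inj; move: e1 e2; case: (enc c) (enc d) => ? ? [? ?] /= -> ->.
have cell_atE (x l : 'I_n) : cell_at enc x l = (((x : nat)%:Z - s, (l : nat)%:Z - s) \in T).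
  apply/codomP/idP => [[c ec]|xlT].
    have := encE c; rewrite -ec /= => -[-> ->]; rewrite !addrK.
    by case: c {ec} => -[].
  exists [` xlT]%fset; have /= := encE [` xlT]%fset; rewrite !subrK.
  by case: (enc _) => x' l' /= [[xx'] [ll']]; congr pair; apply: val_inj; rewrite /= ?xx' ?ll'.
have cell_atE' (x l : 'I_n) : cell_at enc' x l = cell_at enc l x.
  by apply/codomP/codomP => -[c ec]; exists c; move: ec; rewrite /enc'; case: (enc c) => ? ? [-> ->].
have eq1 (c d : T) : ((val c).1 == (val d).1) = ((enc c).1 == (enc d).1).
  rewrite -(inj_eq val_inj) -eqz_nat /=.
  by have [-> _] := encE c; have [-> _] := encE d; rewrite (inj_eq (addIr s)).
have eq2 (c d : T) : ((val c).2 == (val d).2) = ((enc c).2 == (enc d).2).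
  rewrite -(inj_eq val_inj) -eqz_nat /=.
  by have [_ ->] := encE c; have [_ ->] := encE d; rewrite (inj_eq (addIr s)).
have lt1 (c d : T) : ((val c).1 < (val d).1) = ((enc c).1 < (enc d).1)%N.
  by have [] := encE c; have [] := encE d; lia.
have lt2 (c d : T) : ((val c).2 < (val d).2) = ((enc c).2 < (enc d).2)%N.
  by have [] := encE c; have [] := encE d; lia.
have rectE (c d : T) : (rect (val c) (val d) `<=` T)%fset =
    cell_at enc (enc c).1 (enc d).2 && cell_at enc (enc d).1 (enc c).2.
  rewrite rect_subset ?(valP c) ?(valP d) // !cell_atE.
  by have [-> ->] := encE c; have [-> ->] := encE d; rewrite !addrK.
have ne2E F : cell_chains enc true F = ne2 F.
  apply: eq_card => -[c d]; rewrite !inE /cell_chain /ascent /= lt1 lt2.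
  by rewrite rectE.
have se2E F : cell_chains enc false F = se2 F.
  apply: eq_card => -[c d]; rewrite !inE /cell_chain /descent /= lt1 lt2.
  by rewrite rectE.
have ne2E' F : cell_chains enc' true F = ne2 F.
  apply: eq_card => -[c d]; rewrite !inE /cell_chain /ascent /= lt1 lt2 !cell_atE'.
  by rewrite rectE andbCA; do !bool_congr.
have se2E' F : cell_chains enc' false F = se2 F.
  (* Transposition preserves the order of the cells of an ascent but exchanges the two cells of a
     descent. *)
  pose swap (cd : T * T) := (cd.2, cd.1).
  have swapK : involutive swap by case.
  rewrite /se2 -(card_preimset _ (inv_inj swapK)).
  apply: eq_card => -[c d]; rewrite !inE /cell_chain /descent /= lt1 lt2 !cell_atE'.
  by rewrite rectE; do !bool_congr.
have memC F : (F \in fillings_c T) = one_per_col enc F.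
  by rewrite inE; do 2! [apply: eq_forallb => ?]; rewrite eq1.
have memR F : (F \in fillings_r T) = one_per_row enc F.
  by rewrite inE; do 2! [apply: eq_forallb => ?]; rewrite eq2.
have [row_conv col_conv] := conv.
have sub_rows (a b : 'I_n) : {subset row_of T (a%:Z - s) <= row_of T (b%:Z - s)} ->
    row_support (cell_at enc) a \subset row_support (cell_at enc) b.
  move=> sub; apply/subsetP => x; rewrite !inE !cell_atE => xa.
  by have := sub (x%:Z - s); rewrite !inE; apply.
have nest (a b : 'I_n) : row_support (cell_at enc) a \subset row_support (cell_at enc) b \/
    row_support (cell_at enc) b \subset row_support (cell_at enc) a.
  by have [/sub_rows|/sub_rows] := free (a%:Z - s) (b%:Z - s); [left|right].
have nest' (a b : 'I_n) : row_support (cell_at enc') a \subset row_support (cell_at enc') b \/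
    row_support (cell_at enc') b \subset row_support (cell_at enc') a.
  (* Nested rows force nested columns: if column [a] has a row [l] missing from column [b], then a
     row [l'] of [b] cannot be contained in [l], so it contains [l] and hence meets [a]. *)
  case: (boolP (_ \subset _)) => [|/subsetPn[l]]; first by left.
  rewrite !inE !cell_atE' => al bl; right; apply/subsetP => l'; rewrite !inE !cell_atE' => bl'.
  have [/subsetP/(_ a)|/subsetP/(_ b)] := nest l l'; rewrite !inE; first exact.
  by move/(_ bl'); rewrite (negbTE bl).
have conv_up (x a b c : 'I_n) : (a <= b <= c)%N ->
    cell_at enc x a -> cell_at enc x c -> cell_at enc x b.
  by move=> abc; rewrite !cell_atE; apply: (col_conv (x%:Z - s)); lia.
have conv_right (x a b c : 'I_n) : (a <= b <= c)%N ->
    cell_at enc' x a -> cell_at enc' x c -> cell_at enc' x b.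
  by move=> abc; rewrite !cell_atE' !cell_atE; apply: (row_conv (x%:Z - s)); lia.
have sym b := encoded_fillings_symmetric enc_inj b p q conv_up nest.
have sym' := encoded_fillings_symmetric enc'_inj false p q conv_right nest'.
case: hB => [->|[->|->]].
- by etransitivity; [etransitivity; [|exact: (sym true)]|];
    apply: eq_big => F; rewrite /= ?in_setI ?memC ?memR ?ne2E ?se2E.
- by etransitivity; [etransitivity; [|exact: (sym false)]|];
    apply: eq_big => F; rewrite /= ?memC ?andbT ?ne2E ?se2E.
(* [one_per_row enc] and [one_per_col enc'] are the same condition by computation. *)
- by etransitivity; [etransitivity; [|exact: sym']|];
    apply: eq_big => F; rewrite /= ?memR ?andbT ?ne2E' ?se2E'.
Qed.
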